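(* Let $X$ and $Y$ be normed spaces, and let $U\subset X$ and $V\subset Y$ be open sets. Let $\emptyset\neq L\subset S_X$ and $\emptyset\neq M\subset S_Y$. Let $F:X\rightrightarrows Y$ be a set-valued mapping, $g:X\to Y$ a single-valued mapping, and let $\tau>0$. Assume that: (i) $F$ is Milyutin directionally regular on $U\times V$ w.r.t. $L$ and $M$ with constant $\tau$; (ii) $F$ is Milyutin directionally regular on $U\times V$ w.r.t. $-L$ and $-M$ with the same constant $\tau$; (iii) there exists $\lambda\in(0,\tau^{-1})$ such that, for every $u\in U$ and every $v\in u+\operatorname{cone}L$, $$T_{-M}(g(u),g(v))\le\lambda T_L(u,v),$$ and, for every $u\in U$ and every $v\in u-\operatorname{cone}L$, $$T_M(g(u),g(v))\le\lambda T_{-L}(u,v);$$ (iv) there exists an open set $W\subset Y$ such that $W-g(U)\subset V$. Let $(x,y)\in U\times W$ satisfy $$0<(\tau^{-1}-\lambda)^{-1}T_M(y,F(x)+g(x))<\mathbf{d}(x,X\setminus U),$$ and define the set-valued mapping $R_y:=F^{-1}\circ(-g+y)$, i.e. $R_y(u)=F^{-1}(y-g(u))$ for $u\in X$. Then the following assertions hold. (a) For every $\varepsilon>0$, $\operatorname{Fix}(R_y)(\varepsilon)\cap U\neq\emptyset$, and $$\mathbf{d}\bigl(x,\operatorname{Fix}(R_y)(\varepsilon)\cap U\bigr)\le\frac{\tau}{1-\tau\lambda}T_M(y,F(x)+g(x)).$$ (b) If $X$ is Banach, $\operatorname{Gr}F$ is closed and $g$ is continuous, then $\operatorname{Fix}(R_y)\cap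 U\neq\emptyset$, and $$\mathbf{d}\bigl(x,\operatorname{Fix}(R_y)\cap U\bigr)\le\frac{\tau}{1-\tau\lambda}T_M(y,F(x)+g(x)).$$ Equivalently, $$\mathbf{d}\bigl(x,(F+g)^{-1}(y)\cap U\bigr)\le\frac{\tau}{1-\tau\lambda}T_M(y,F(x)+g(x)).$$
   Context: $S_X,S_Y$ are unit spheres; $\operatorname{cone}L=\{tu:t\ge0,u\in L\}$; $\mathbf{d}(x,A)=\inf_{a\in A}\|x-a\|$ with $\mathbf{d}(x,\emptyset)=+\infty$; $\operatorname{Gr}F=\{(x,y):y\in F(x)\}$; $F^{-1}(y)=\{x:y\in F(x)\}$; $W-g(U)=\{w-g(u):w\in W,u\in U\}$; $(F+g)(x)=F(x)+g(x)$. For $\emptyset\ne L\subset S_X$, $A\subset X$, the directional minimal time function is $T_L(x,A):=\inf\{t\ge0:(x+tL)\cap A\ne\emptyset\}$ with $\inf\emptyset=+\infty$, and $T_L(x,u):=T_L(x,\{u\})$; similarly on $Y$. For $R:X\rightrightarrows X$: $\operatorname{Fix}(R)(\varepsilon):=\{u\in X:\mathbf{d}(u,R(u))\le\varepsilon\}$ and $\operatorname{Fix}(R):=\{u\in X:u\in R(u)\}$. $F$ is Milyutin directionally regular on $U\times V$ w.r.t. $L$ and $M$ with constant $\tau$ if for every $(x,y)\in U\times V$: $\tau T_M(y,F(x))<\mathbf{d}(x,X\setminus U)\Rightarrow T_L(x,F^{-1}(y))\le\tau T_M(y,F(x))$; the version w.r.t. $-L$ and $-M$ replaces $L,M$ by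 $-L,-M$. *)

(* Defs.v *)
From HB Require Import structures.
From mathcomp Require Import all_boot all_order all_algebra.
From mathcomp Require Import all_classical all_reals all_analysis.
Set Implicit Arguments.
Unset Strict Implicit.
Unset Printing Implicit Defensive.
Import Order.TTheory GRing.Theory Num.Theory.
Import numFieldNormedType.Exports.
Local Open Scope classical_set_scope.
Local Open Scope ring_scope.

(* Set-valued mappings X => Y are functions X -> set Y, with empty values
   allowed. *)

Section NormedSpace.
Context {R : realType} {X : normedModType R}.
Implicit Types (L A : set X) (x u : X).

Definition unit_sphere : set X := [set x | `|x| = 1].

Definition cone L : set X := [set t *: u | t in [set t : R | 0 <= t] & u in L].

Definition oppset L : set X := [set - u | u in L].

(* ereal_inf set0 = +oo, so dist x set0 = +oo. *)
Definition dist x A : \bar R := ereal_inf [set (`|x - a|)%:E | a in A].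

Definition min_time L x A : \bar R :=
  ereal_inf [set t%:E | t in
    [set t : R | 0 <= t /\ [set x + t *: l | l in L] `&` A !=set0]].

Definition Fix_approx (S : X -> set X) (e : R) : set X :=
  [set u | (dist u (S u) <= e%:E)%E].

Definition Fix (S : X -> set X) : set X := [set u | S u u].

End NormedSpace.

(* Completeness of the norm uniformity as a property of a normed space; it is
   the field cauchy_cvg of completeNormedModType, which cannot be used when only
   part of a statement assumes completeness. *)
Definition banach {R : realType} (X : normedModType R) : Prop :=
  forall G : set_system X, ProperFilter G -> cauchy G -> cvg G.

Section SetValued.
Context {R : realType} {X Y : normedModType R}.
Implicit Types (F : X -> set Y) (g : X -> Y).

Definition graph F : set (X * Y) := [set p | F p.1 p.2].

Definition sv_inv F (y : Y) : set X := [set x | F x y].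

Definition sv_add F g (x : X) : set Y := [set z + g x | z in F x].

Definition fix_map F g (y : Y) (u : X) : set X := sv_inv F (y - g u).

Definition milyutin_regular F (U : set X) (V : set Y) (L : set X) (M : set Y)
    (tau : R) : Prop :=
  forall x y, U x -> V y ->
    (tau%:E * min_time M y (F x) < dist x (~` U))%E ->
    (min_time L x (sv_inv F y) <= tau%:E * min_time M y (F x))%E.

End SetValued.

(* Main.v *)
(** Iterate u_(n+1) in F^-1(y - g u_n), with |u_(n+1) - u_n| = t_n and
    q = tau lambda < 1.  If u_(n+1) - u_n has a direction in L, then
    g u_(n+1) - g u_n is a multiple of an element of -M by a factor at most
    lambda t_n (up to an arbitrarily small error).  As y - g u_n lies in F(u_(n+1)),
    the point y - g u_(n+1) therefore reaches F(u_(n+1)) along -M within time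
    lambda t_n, and regularity with respect to -L, -M provides the next step, of
    length less than q r_n as soon as t_n < r_n.  The signs alternate, and the steps are
    dominated by the geometric sequence r_n = q^n r_0, where r_0 may be any
    number slightly larger than tau T_M(y, F x + g x).  The displacement from x
    is at most s = r_0 / (1 - q), which keeps the sequence inside U.  Steps
    tend to 0, which gives the approximate fixed points; under completeness the
    limit is a fixed point because the graph of F is closed. *)
Require Import Defs.
From HB Require Import structures.
From mathcomp Require Import all_boot all_order all_algebra.
From mathcomp Require Import all_classical all_reals all_analysis.
From mathcomp Require Import ring lra.
Set Implicit Arguments.
Unset Strict Implicit.
Unset Printing Implicit Defensive.
Import Order.TTheory GRing.Theory Num.Theory.
Import numFieldNormedType.Exports.
Local Open Scope classical_set_scope.
Local Open Scope ring_scope.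

Section MinTime.
Context {R : realType} {Z : normedModType R}.
Implicit Types (L A : set Z) (x : Z) (r t : R).

(** The infimum need not be attained, so a time and a direction come only from a strict bound; hence
    the strict inequalities in the iteration. *)
Lemma min_time_lt L x A r : (min_time L x A < r%:E)%E ->
  exists t l, [/\ 0 <= t, t < r, L l & A (x + t *: l)].
Proof.
move=> /ereal_inf_lt[_ [t [t0 [_ [[l Ll <-] Axl]]] <-]].
by rewrite lte_fin => tr; exists t, l.
Qed.

Lemma min_time_le L x A t l : 0 <= t -> L l -> A (x + t *: l) ->
  (min_time L x A <= t%:E)%E.
Proof.
move=> t0 Ll Axl; apply: ereal_inf_lbound; exists t => //; split => //.
by exists (x + t *: l); split => //; exists l.
Qed.

Lemma dist_le x A a : A a -> (dist x A <= `|x - a|%:E)%E.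
Proof. by move=> Aa; apply: ereal_inf_lbound; exists a. Qed.

Lemma le_dist x A r : (forall a, A a -> r <= `|x - a|) -> (r%:E <= dist x A)%E.
Proof. by move=> rA; apply: le_ereal_inf_tmp => _ [a /rA + <-]; rewrite lee_fin. Qed.

Lemma min_time_ge0 L x A : (0 <= min_time L x A)%E.
Proof. by apply: le_ereal_inf_tmp => _ [t [t0 _] <-]; rewrite lee_fin. Qed.

Lemma oppset_sphere L : L `<=` unit_sphere -> oppset L `<=` unit_sphere.
Proof. by move=> LS _ [l /LS Ll <-]; rewrite /unit_sphere /= normrN. Qed.

End MinTime.

Lemma min_time_sv_add (R : realType) (X Y : normedModType R) (M : set Y)
    (F : X -> set Y) (g : X -> Y) (x : X) (y : Y) :
  min_time M y (sv_add F g x) = min_time M (y - g x)%R (F x).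
Proof.
rewrite /min_time; congr ereal_inf; congr image; apply/seteqP.
split=> t [t0 [_ [[m Mm <-]]]] => [[z Fz zE]|Fz]; split => //.
- exists z; split => //; exists m => //.
  by rewrite -(addrK (g x) z) zE addrAC.
- exists (y + t *: m); split; first by exists m.
  by exists (y - g x + t *: m) => //; rewrite addrAC subrK.
Qed.

Lemma Fix_fix_mapE (R : realType) (X Y : normedModType R)
    (F : X -> set Y) (g : X -> Y) (y : Y) :
  Fix (fix_map F g y) = sv_inv (sv_add F g) y.
Proof.
apply/seteqP; split => u; rewrite /Fix /fix_map /sv_inv /sv_add /=.
- by move=> Fu; exists (y - g u); rewrite ?subrK.
- by move=> [z Fz <-]; rewrite addrK.
Qed.

(* [LL b] and [MM b] stand for L, M when [b] is false and for -L, -M when [b]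
   is true; the n-th step of the iteration uses the sign [odd n]. *)
Section PicardIteration.
Context {R : realType} {X Y : normedModType R}.
Variables (U : set X) (V : set Y) (LL : bool -> set X) (MM : bool -> set Y).
Variables (F : X -> set Y) (g : X -> Y) (tau lambda : R) (y : Y).
Hypothesis LLS : forall b, LL b `<=` unit_sphere.
Hypotheses (tau0 : 0 < tau) (lambda0 : 0 < lambda) (q1 : tau * lambda < 1).
Hypothesis reg : forall b, milyutin_regular F U V (LL b) (MM b) tau.
Hypothesis g_lip : forall b u (t : R) l, U u -> 0 <= t -> LL b l ->
  (min_time (MM (~~ b)) (g u) [set g (u + t *: l)%R] <= (lambda * t)%:E)%E.
Hypothesis yV : forall u, U u -> V (y - g u).
Local Notation q := (tau * lambda).

Lemma picard_step b u (r : R) : U u ->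
    (tau%:E * min_time (MM b) (y - g u)%R (F u) < r%:E)%E ->
    (r%:E <= dist u (~` U))%E ->
  exists v, [/\ `|v - u| <= r, F v (y - g u) &
    (tau%:E * min_time (MM (~~ b)) (y - g v)%R (F v) < (q * r)%:E)%E].
Proof.
move=> Uu Tr rU.
have := reg Uu (yV Uu) (lt_le_trans Tr rU).
move=> /le_lt_trans /(_ Tr) /min_time_lt[t [l [t0 tr Ll Fv]]].
exists (u + t *: l); split=> //.
  by rewrite addrAC subrr add0r normrZ (LLS Ll) mulr1 ger0_norm // ltW.
have ltr : ((lambda * t)%:E < (lambda * r)%:E)%E by rewrite lte_fin ltr_pM2l.
have /min_time_lt[s [m [s0 sr Mm gE]]] := le_lt_trans (g_lip Uu t0 Ll) ltr.
(* With [v = u + t *: l], [gE] says [g u + s *: m = g v], so moving from [y - g v] by [s *: m] leads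
   back to [y - g u], a point of [F v]. *)
have Ts : (min_time (MM (~~ b)) (y - g (u + t *: l))%R (F (u + t *: l)%R) <= s%:E)%E.
  by apply: (min_time_le s0 Mm); rewrite -gE opprD addrA addrNK.
apply: (@le_lt_trans _ _ (tau * s)%:E); last by rewrite lte_fin -mulrA ltr_pM2l.
by rewrite EFinM lee_pmul2l // lte_fin.
Qed.

(** The bounds [r_n = s (1 - q) q^n] are written as differences [s (q^n - q^(n+1))], so that they
    telescope: the first n steps move x by at most [s (1 - q^n)]. *)
Lemma picard_sequence x (s : R) : 0 < s -> (forall a, `|x - a| <= s -> U a) ->
    (tau%:E * min_time (MM false) (y - g x)%R (F x) < (s * (1 - q))%:E)%E ->
  exists u : nat -> X, [/\ forall n, `|x - u n| <= s * (1 - q ^+ n),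
    forall n, F (u n.+1) (y - g (u n)) &
    forall n, `|u n.+1 - u n| <= s * (q ^+ n - q ^+ n.+1)].
Proof.
move=> s0 sU Tx.
have q0 : 0 < q by rewrite mulr_gt0.
have qn n : 0 < q ^+ n by rewrite exprn_gt0.
pose P n u := `|x - u| <= s * (1 - q ^+ n) /\
  (tau%:E * min_time (MM (odd n)) (y - g u)%R (F u)
     < (s * (q ^+ n - q ^+ n.+1))%:E)%E.
pose Q n u v := [/\ P n.+1 v, F v (y - g u) &
  `|v - u| <= s * (q ^+ n - q ^+ n.+1)].
(* The invariant is a premise inside the existential, so that [choice] yields a function on all
   pairs; where [P] fails, any witness will do. *)
have step (nu : nat * X) : exists v, P nu.1 nu.2 -> Q nu.1 nu.2 v.
  case: nu => n u /=; have [[ux Tu]|nP] := pselect (P n u); last by exists u.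
  have Uu : U u.
    apply: sU; apply: (le_trans ux); have := qn n; nra.
  (* A point closer to u than [r_n] is within [s (1 - q^(n+1)) <= s] of x, hence in U. *)
  have rU : ((s * (q ^+ n - q ^+ n.+1))%:E <= dist u (~` U))%E.
    apply: le_dist => a Ua; rewrite leNgt; apply/negP => ua; apply: Ua.
    apply: sU; apply: (le_trans (ler_distD u _ _)).
    have := qn n.+1; nra.
  have [v [vu Fv Tv]] := picard_step Uu Tu rU.
  exists v => _; split => //; split.
    apply: (le_trans (ler_distD u _ _)); rewrite (distrC u); lra.
  by rewrite /= (_ : s * _ = q * (s * (q ^+ n - q ^+ n.+1))) // !exprS; ring.
have [f fP] := choice step.
pose u := fix u n := if n is m.+1 then f (m, u m) else x.
have Pu n : P n (u n).
  elim: n => [|n IH]; last by have [] := fP (n, u n) IH.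
  by rewrite /P /= expr0 expr1 !subrr normr0 mulr0.
exists u; split=> n; first by have [] := Pu n.
- by have [] := fP (n, u n) (Pu n).
- by have [] := fP (n, u n) (Pu n).
Qed.

Lemma approx_fixed_point x (s e : R) : 0 < s -> (forall a, `|x - a| <= s -> U a) ->
    (tau%:E * min_time (MM false) (y - g x)%R (F x) < (s * (1 - q))%:E)%E ->
    0 < e ->
  exists u, Fix_approx (fix_map F g y) e u /\ `|x - u| <= s.
Proof.
move=> s0 sU Tx e0; have [u [ux Fu uS]] := picard_sequence s0 sU Tx.
have q0 : 0 < q by rewrite mulr_gt0.
have /cvgrPdist_lt/(_ (e / s)) : (fun n => q ^+ n) @ \oo --> (0 : R).
  by apply: cvg_expr; rewrite ger0_norm // ltW.
rewrite divr_gt0 // => /(_ isT)[N _ /(_ N (leqnn N))] /=.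
rewrite sub0r normrN ger0_norm ?exprn_ge0 ?(ltW q0) // ltr_pdivlMr // => qe.
exists (u N); split.
  (* Since [u N.+1] lies in [fix_map F g y (u N)], the length of step N bounds the distance, and it
     is below [s q^N < e]. *)
  apply: (@le_trans _ _ `|u N - u N.+1|%:E); first exact: (@dist_le _ _ _ (fix_map F g y (u N))).
  rewrite lee_fin distrC; apply: (le_trans (uS N)).
  have : 0 < q ^+ N.+1 by rewrite exprn_gt0. nra.
apply: (le_trans (ux N)); have : 0 < q ^+ N by rewrite exprn_gt0. nra.
Qed.

Lemma exact_fixed_point x (s : R) : 0 < s -> (forall a, `|x - a| <= s -> U a) ->
    (tau%:E * min_time (MM false) (y - g x)%R (F x) < (s * (1 - q))%:E)%E ->
    banach X -> closed (graph F) -> continuous g ->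
  exists u, Fix (fix_map F g y) u /\ `|x - u| <= s.
Proof.
move=> s0 sU Tx banX clF cg; have [u [ux Fu uS]] := picard_sequence s0 sU Tx.
have q0 : 0 < q by rewrite mulr_gt0.
have uD n m : `|u (n + m)%N - u n| <= s * (q ^+ n - q ^+ (n + m)%N).
  elim: m => [|m IH]; first by rewrite addn0 !subrr normr0 mulr0.
  rewrite addnS; apply: (le_trans (ler_distD (u (n + m)%N) _ _)).
  have := uS (n + m)%N; lra.
have cu : cauchy (u @ \oo).
  apply: cauchy_exP => e e0.
  have /cvgrPdist_lt/(_ (e / s)) : (fun n => q ^+ n) @ \oo --> (0 : R).
    by apply: cvg_expr; rewrite ger0_norm // ltW.
  rewrite divr_gt0 // => /(_ isT)[N _ /(_ N (leqnn N))] /=.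
  rewrite sub0r normrN ger0_norm ?exprn_ge0 ?(ltW q0) // ltr_pdivlMr // => qe.
  exists (u N), N => // n /= Nn; rewrite -ball_normE /ball_ /= distrC.
  rewrite -(subnKC Nn); apply: (le_lt_trans (uD _ _)).
  have : 0 < q ^+ (N + (n - N))%N by rewrite exprn_gt0. nra.
have /cvg_ex[z uz] : cvg (u @ \oo) by exact: banX.
exists z; split.
  (* The graph points [(u n.+1, y - g (u n))] converge to [(z, y - g z)]. *)
  have : graph F (z, y - g z); last by [].
  apply: (closed_cvg _ clF (u_ := fun n => (u n.+1, y - g (u n))) (F := \oo)).
    by near=> n; exact: Fu.
  apply: cvg_pair; first by rewrite cvg_shiftS.
  apply: cvgB; first exact: cvg_cst.
  exact: (@cvg_comp _ _ _ u g _ _ _ uz (cg z)).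
have xz : (fun n => `|x - u n|) @ \oo --> `|x - z|.
  by apply: cvg_norm; apply: cvgB => //; exact: cvg_cst.
rewrite -(cvg_lim _ xz) //; apply: limr_le; first by apply/cvg_ex; exists `|x - z|.
near=> n; apply: (le_trans (ux n)).
have : 0 < q ^+ n by rewrite exprn_gt0. nra.
Unshelve. all: by end_near. Qed.

End PicardIteration.

(** The iteration works for each radius s strictly above k, and [rho] caps s so that the ball stays
    in U; letting s decrease to k gives the sharp constant. *)
Lemma dist_le_approx (R : realType) (X : normedModType R) (x : X) (A : set X)
    (k rho : R) : k < rho ->
  (forall s, k < s -> s < rho -> exists2 a, A a & `|x - a| <= s) ->
  A !=set0 /\ (dist x A <= k%:E)%E.
Proof.
move=> krho H; split.
  by have [||a Aa _] := H ((k + rho) / 2); [lra|lra|exists a].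
apply/lee_addgt0Pr => e e0.
have [||a Aa xa] := H (Num.min (k + e) ((k + rho) / 2)).
- by rewrite lt_min; apply/andP; split; lra.
- by rewrite gt_min; apply/orP; right; lra.
apply: (le_trans (dist_le x Aa)); rewrite -EFinD lee_fin (le_trans xa)//.
by rewrite ge_min lexx.
Qed.

Theorem theorem4p7 (R : realType) (X Y : normedModType R)
    (U : set X) (V : set Y) (L : set X) (M : set Y)
    (F : X -> set Y) (g : X -> Y) (tau lambda : R) (W : set Y)
    (x : X) (y : Y)
    (openU : open U) (openV : open V)
    (L0 : L !=set0) (LS : L `<=` unit_sphere)
    (M0 : M !=set0) (MS : M `<=` unit_sphere)
    (tau0 : 0 < tau)
    (regLM : milyutin_regular F U V L M tau)
    (regNLM : milyutin_regular F U V (oppset L) (oppset M) tau)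
    (lambda0 : 0 < lambda) (lambda_lt : lambda < tau^-1)
    (g_fwd : forall u v, U u -> [set u + c | c in cone L] v ->
       (min_time (oppset M) (g u) [set g v]
          <= lambda%:E * min_time L u [set v])%E)
    (g_bwd : forall u v, U u -> [set u - c | c in cone L] v ->
       (min_time M (g u) [set g v]
          <= lambda%:E * min_time (oppset L) u [set v])%E)
    (openW : open W)
    (WgV : [set w - z | w in W & z in g @` U] `<=` V)
    (Ux : U x) (Wy : W y)
    (Txy_gt0 : (0 < (tau^-1 - lambda)^-1%:E * min_time M y (sv_add F g x))%E)
    (Txy_lt : ((tau^-1 - lambda)^-1%:E * min_time M y (sv_add F g x)
                 < dist x (~` U))%E) :
  (forall e : R, 0 < e ->
     (Fix_approx (fix_map F g y) e `&` U !=set0) /\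
     (dist x (Fix_approx (fix_map F g y) e `&` U)
        <= (tau / (1 - tau * lambda))%:E * min_time M y (sv_add F g x))%E)
  /\
  (banach X -> closed (graph F) -> continuous g ->
     [/\ Fix (fix_map F g y) `&` U !=set0,
         (dist x (Fix (fix_map F g y) `&` U)
            <= (tau / (1 - tau * lambda))%:E * min_time M y (sv_add F g x))%E &
         (dist x (sv_inv (sv_add F g) y `&` U)
            <= (tau / (1 - tau * lambda))%:E * min_time M y (sv_add F g x))%E]).
Proof.
pose LL b := if b then oppset L else L.
pose MM b := if b then oppset M else M.
have q1 : tau * lambda < 1 by rewrite -ltr_pdivlMl // mulr1.
have LLS b : LL b `<=` unit_sphere by case: b => //; exact: oppset_sphere.
have reg b : milyutin_regular F U V (LL b) (MM b) tau by case: b.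
have g_lip b u (t : R) l : U u -> 0 <= t -> LL b l ->
    (min_time (MM (~~ b)) (g u) [set g (u + t *: l)%R] <= (lambda * t)%:E)%E.
  move=> Uu t0 Ll.
  have Tt : (min_time (LL b) u [set u + t *: l]%R <= t%:E)%E.
    exact: min_time_le t0 Ll _.
  apply: (@le_trans _ _ (lambda%:E * min_time (LL b) u [set u + t *: l]%R)%E).
    case: b Ll {Tt} => /= Ll; last first.
      by apply: g_fwd => //; exists (t *: l) => //; exists t => //; exists l.
    apply: g_bwd => //; case: Ll => l' Ll' <-; exists (t *: l').
      by exists t => //; exists l'.
    by rewrite scalerN.
  by rewrite EFinM lee_pmul2l // lte_fin.
have yV u : U u -> V (y - g u).
  by move=> Uu; apply: WgV; exists y => //; exists (g u) => //; exists u.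
have cE : (tau^-1 - lambda)^-1 = tau / (1 - tau * lambda).
  field; rewrite !gt_eqF //= ?subr_gt0 //.
have c0 : 0 < tau / (1 - tau * lambda) by rewrite divr_gt0 // subr_gt0.
rewrite cE in Txy_gt0 Txy_lt; move: Txy_lt.
rewrite !min_time_sv_add.
have := min_time_ge0 M (y - g x) (F x).
case TE : (min_time M (y - g x)%R (F x)) => [T| |] // T0; last first.
  by rewrite gt0_muley ?lte_fin // ltNge leey.
rewrite -EFinM => kD; rewrite lee_fin in T0.
set k := _ * T in kD *.
(* The distance is infinite when U is the whole space; [k + 1] then serves as [rho]. *)
have [rho krho rhoD] : exists2 rho : R, k < rho & (rho%:E <= dist x (~` U))%E.
  case: (dist x (~` U)) kD => [d| |] //; first by exists d.
  by move=> _; exists (k + 1); rewrite ?leey // ltrDl.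
have sU s : s < rho -> forall a, `|x - a| <= s -> U a.
  move=> srho a xa; apply: contrapT => Ua.
  have := le_trans rhoD (dist_le x Ua); rewrite lee_fin; lra.
have k0 : 0 <= k by rewrite mulr_ge0 // ltW.
have Ts s : k < s -> (tau%:E * min_time (MM false) (y - g x)%R (F x)
    < (s * (1 - tau * lambda))%:E)%E.
  rewrite /= TE -EFinM lte_fin -ltr_pdivrMr ?subr_gt0 //.
  by rewrite mulrAC.
split=> [e e0|banX clF cg].
  apply: (dist_le_approx krho) => s ks srho.
  have s0 : 0 < s by exact: le_lt_trans ks.
  have [u [Fu xu]] := approx_fixed_point LLS tau0 lambda0 q1 reg g_lip yV s0
    (sU _ srho) (Ts _ ks) e0.
  by exists u => //; split => //; exact: sU xu.
(* Both distance estimates now concern the same set. *)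
rewrite -Fix_fix_mapE.
suff [A0 Ak] : Fix (fix_map F g y) `&` U !=set0 /\
    (dist x (Fix (fix_map F g y) `&` U) <= k%:E)%E by [].
apply: (dist_le_approx krho) => s ks srho.
have s0 : 0 < s by exact: le_lt_trans ks.
have [u [Fu xu]] := exact_fixed_point LLS tau0 lambda0 q1 reg g_lip yV s0
  (sU _ srho) (Ts _ ks) banX clF cg.
by exists u => //; split => //; exact: sU xu.
Qed.
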